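(* There exist constants $0<C,C'<\infty$ such that the following holds. Let $\lambda=(\lambda_1,\dots,\lambda_r)$ be a partition of $n$, let $\alpha=(\alpha_1,\dots,\alpha_r)$ with $\alpha_i=\lambda_i/n$, $H(\alpha)=-\sum_{i=1}^r\alpha_i\log\alpha_i$, $H'(\alpha)=-\sum_{i=2}^r\alpha_i\log\alpha_i$, $M=\lfloor 1/(1-\alpha_1)\rfloor$, and $$\gamma(\alpha)=\frac{M}{M+1}\left[1-C'\,\frac{H(\alpha)-H'(\alpha)}{H(\alpha)}\right].$$ If $f$ is generated by the random model $R(K,\mathcal C)$ with $K\le C\,D_\lambda^{\gamma(\alpha)}$, then with probability $1-o(1)$ as $n\to\infty$ the sparsest-fit algorithm applied to $\hat f(\lambda)$ recovers $f$.
   Context: $\log$ is the natural logarithm. $S_n$ is the symmetric group on $\{1,\dots,n\}$. For a partition $\lambda=(\lambda_1,\dots,\lambda_r)$ of $n$ ($\lambda_1\ge\dots\ge\lambda_r\ge1$), a $\lambda$-partition of $\{1,\dots,n\}$ is an ordered tuple $(B_1,\dots,B_r)$ of disjoint sets with $|B_i|=\lambda_i$ and union $\{1,\dots,n\}$; there are $D_\lambda=n!/\prod_i\lambda_i!$ of them, enumerated $t_1,\dots,t_{D_\lambda}$; $\sigma$ acts by $\sigma(B_1,\dots,B_r)=(\sigma(B_1),\dots,\sigma(B_r))$. $M^\lambda(\sigma)$ is the $D_\lambda\times D_\lambda$ $0/1$ matrix with $M^\lambda_{ij}(\sigma)=1$ iff $\sigma(t_j)=t_i$, and $\hat f(\lambda)=\sum_\sigma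 f(\sigma)M^\lambda(\sigma)$. Random model $R(K,\mathcal C)$: for fixed $\mathcal C=[a,b]$, $0<a<b$, choose $\sigma_1,\dots,\sigma_K$ i.i.d. uniform from $S_n$ (with replacement) and $p_1,\dots,p_K$ i.i.d. uniform on $\mathcal C$; $f(\sigma)=p_i$ if $\sigma=\sigma_i$, else $0$. Sparsest-fit algorithm: input the nonzero entries $q_1\le\dots\le q_L$ of $\hat f(\lambda)$ sorted ascending (with their matrix positions). Initialize $p_0=0$, $k(0)=0$, all $A_k=\emptyset$. For $\ell=1,\dots,L$: if $q_\ell=\sum_{k\in T}p_k$ for some $T\subseteq\{0,\dots,k(\ell-1)\}$, set $k(\ell)=k(\ell-1)$ and add $\ell$ to $A_k$ for $k\in T$; else set $k(\ell)=k(\ell-1)+1$, $p_{k(\ell)}=q_\ell$, add $\ell$ to $A_{k(\ell)}$. Output $(p_k,A_k)_{1\le k\le k(L)}$; each $A_k$ (a set of matrix positions) is read as the support of $M^\lambda(\sigma_k)$, giving a permutation $\sigma_k$ with value $p_k$. ''Recovers $f$'' means the resulting function equals $f$. *)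

(* Defs.v *)
From HB Require Import structures.
From mathcomp Require Import all_boot all_order all_algebra all_fingroup.
From mathcomp Require Import all_classical all_reals all_analysis.
Set Implicit Arguments. Unset Strict Implicit. Unset Printing Implicit Defensive.
Import Order.TTheory GRing.Theory Num.Theory.
Import numFieldNormedType.Exports.
Local Open Scope ring_scope.

Definition is_partition (n : nat) (lam : seq nat) : bool :=
  [&& sorted geq lam, all (fun x => 0 < x)%N lam & sumn lam == n].

Section Tabloids.
Variables (n : nat) (lam : seq nat).

Definition tup := {ffun 'I_(size lam) -> {set 'I_n}}.

Definition is_lpart (t : tup) : bool :=
  [&& [forall i, #|t i| == nth 0%N lam i],
      [forall i, forall j, (i != j) ==> [disjoint t i & t j]] &
      \bigcup_i t i == [set: 'I_n]].

Definition Dlam : nat := #|[pred t : tup | is_lpart t]|.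

Definition act (s : {perm 'I_n}) (t : tup) : tup := [ffun i => s @: t i].

(* matrix positions (t_i, t_j), indexed directly by the lam-partitions *)
Definition positions : seq (tup * tup) :=
  [seq (s, t) | s <- enum [pred t : tup | is_lpart t],
                t <- enum [pred t : tup | is_lpart t]].

Definition suppM (s : {perm 'I_n}) : {set tup * tup} :=
  [set st | [&& is_lpart st.1, is_lpart st.2 & act s st.2 == st.1]].

Variable R : realType.

Definition fhat (f : {perm 'I_n} -> R) (st : tup * tup) : R :=
  \sum_(s : {perm 'I_n}) f s * (act s st.2 == st.1)%:R.

Fixpoint masks (k : nat) : seq (seq bool) :=
  if k is k'.+1 then [seq b :: m | b <- [:: false; true], m <- masks k']
  else [:: [::]].

Definition sf_step (st : seq R * seq {set tup * tup}) (e : R * (tup * tup))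
  : seq R * seq {set tup * tup} :=
  let: (ps, As) := st in
  let: (q, pos) := e in
  match [seq m <- masks (size ps) | \sum_(x <- mask m ps) x == q] with
  | m :: _ => (ps, [seq (if mA.1 then pos |: mA.2 else mA.2) | mA <- zip m As])
  | [::] => (rcons ps q, rcons As [set pos])
  end.

Definition sparsest_fit (f : {perm 'I_n} -> R) : seq (R * {set tup * tup}) :=
  let entries := [seq (fhat f st, st) | st <- positions & fhat f st != 0] in
  let sorted_entries := sort (fun x y => x.1 <= y.1) entries in
  let: (ps, As) := foldl sf_step ([::], [::]) sorted_entries in
  zip ps As.

Definition recovered (out : seq (R * {set tup * tup})) (s : {perm 'I_n}) : R :=
  if [seq x <- out | x.2 == suppM s] is x :: _ then x.1 else 0.

Definition recovers (f : {perm 'I_n} -> R) : Prop :=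
  let out := sparsest_fit f in
  (forall x, x \in out -> exists s, x.2 = suppM s) /\
  (forall s, recovered out s = f s).

Definition model_f (ss : seq {perm 'I_n}) (ps : seq R) (s : {perm 'I_n}) : R :=
  let i := find (pred1 s) ss in
  if (i < size ss)%N then nth 0 ps i else 0.

Definition success (ss : seq {perm 'I_n}) (ps : seq R) : bool :=
  `[< recovers (model_f ss ps) >].

Fixpoint iterint (a b : R) (k : nat) (g : seq R -> \bar R) : \bar R :=
  match k with
  | 0 => g [::]
  | k'.+1 => (\int[@lebesgue_measure R]_(x in `[a, b]%classic)
               iterint a b k' (fun ps => g (x :: ps)))%E
  end.

Definition success_prob (a b : R) (K : nat) : \bar R :=
  (((b - a) ^- K / (n`! ^ K)%:R)%:E *
   \sum_(ss : K.-tuple {perm 'I_n})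
      iterint a b K (fun ps => ((success ss ps)%:R)%:E))%E.

Definition alpha (i : nat) : R := (nth 0%N lam i)%:R / n%:R.
Definition Hent : R := - \sum_(i < size lam) alpha i * ln (alpha i).
Definition Hent' : R := - \sum_(1 <= i < size lam) alpha i * ln (alpha i).
Definition Mfl : R := (Num.floor (1 / (1 - alpha 0)))%:~R.
Definition gamma (C' : R) : R :=
  Mfl / (Mfl + 1) * (1 - C' * ((Hent - Hent') / Hent)).

End Tabloids.

(* Main.v *)
(** Unique witnesses suffice.  Suppose that every permutation [s] in the support
of [f] has a lambda-partition [t] such that no other permutation of the support
sends [t] to [s t], and that distinct subsets of the support have distinct
[f]-sums.  An entry of the Fourier matrix that is a sum of several values is
larger than each of them, so by sortedness all of them were already met through
their witnesses; hence the algorithm only creates a new value at a genuine one.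

Subset sums are distinct as soon as each [p_i] avoids the finitely many
{-1, 0, 1}-combinations of the previous ones, which costs no measure.

Put [L = n - lam_1] and [M = n / L].  The positions [m L, ..., (m+1) L - 1], for
[m < M], carry the blocks 2, 3, ... of [M] lambda-partitions [t_m], which gives
[M] disjoint tails.  If [s_i] has none of them as a witness, some map [phi]
chooses for each [m] another [s_(phi m)] agreeing with [s_i] on [t_m].  A union
bound over [i] and [phi] bounds the failure probability by
[K^(M+1) P^M (n - M L)! / n!], where [P] is the product of the [lam_j!], [j >= 2].

Superadditivity of [3 ln k! - k ln k] gives [n H <= 3 ln D], so [C' = 24] turns
the bound on [K] into [K^(M+1) <= D^M exp (- 8 X)] with [X = M n (H - H')].  One
has [D P = n! / lam_1!], hence [D^M P^M (n - M L)! <= n!] for [M = 1] and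
[<= n^n <= e^n n!] in general, while [X >= (ln n) / 3] always and [X >= n / 4] for
[M >= 2]; the failure probability is therefore at most [1 / n]. *)

Require Import Defs.
From HB Require Import structures.
From mathcomp Require Import all_boot all_order all_algebra all_fingroup.
From mathcomp Require Import all_classical all_reals all_analysis measurable_realfun.
From mathcomp Require Import zify ring lra.
Set Implicit Arguments. Unset Strict Implicit. Unset Printing Implicit Defensive.
Import Order.TTheory GRing.Theory Num.Theory.
Local Open Scope ring_scope.
Local Notation act := Defs.act.

(** * Correctness of the algorithm *)

Lemma mem_masks k (m : seq bool) : (m \in masks k) = (size m == k).
Proof.
elim: k m => [|k IH] m; first by rewrite inE size_eq0.
apply/allpairsP/eqP => [[[b m'] /= [_]]|].
  by rewrite IH => /eqP <- ->.
case: m => // b m /= [sm]; exists (b, m); split => //=; last by rewrite IH sm.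
by rewrite !inE; case: b.
Qed.

Lemma sum_mask (R : nmodType) (T : finType) (f : T -> R) (r : seq T) m :
  uniq r ->
  \sum_(x <- mask m (map f r)) x = \sum_(s in [set s in mask m r]) f s.
Proof.
move=> ur; rewrite -map_mask big_map big_uniq ?mask_uniq //.
by apply: eq_bigl => s; rewrite inE.
Qed.

(** The sets are confined to the support of [f], since a point of value zero could join any set
    without changing its sum. *)
Definition sums_distinct (R : nmodType) (T : finType) (f : T -> R) :=
  forall A B : {set T}, (forall s, s \in A -> f s != 0) ->
    (forall s, s \in B -> f s != 0) ->
    \sum_(s in A) f s = \sum_(s in B) f s -> A = B.

Definition hits n lam (R : realType) (f : {perm 'I_n} -> R)
    (p : tup n lam * tup n lam) : {set {perm 'I_n}} :=
  [set s | (f s != 0) && (act s p.2 == p.1)].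

Lemma fhatE n lam (R : realType) (f : {perm 'I_n} -> R)
    (p : tup n lam * tup n lam) :
  fhat f p = \sum_(s in hits f p) f s.
Proof.
rewrite /fhat [RHS]big_mkcond; apply: eq_bigr => s _; rewrite inE.
by case: (f s =P 0) => [->|_]; case: (_ == p.1); rewrite /= ?mulr1 ?mulr0.
Qed.

(** The part of the matrix support of [s] met so far. Once all entries are read, it is [suppM lam s]
    for each [s] in the support of [f]. *)
Definition entry_set n lam (R : realType) (f : {perm 'I_n} -> R)
    (es : seq (R * (tup n lam * tup n lam))) (s : {perm 'I_n}) :=
  [set p | has (fun e => e.2 == p) es && (s \in hits f p)].

(* After the entries [es], the algorithm has found exactly the permutations
   [r] contributing to some entry of [es]. *)
Definition sf_inv n lam (R : realType) (f : {perm 'I_n} -> R)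
    (es : seq (R * (tup n lam * tup n lam))) st :=
  exists r : seq {perm 'I_n},
    [/\ uniq r, forall s, (s \in r) = has (fun e => s \in hits f e.2) es &
        st = (map f r, map (entry_set f es) r)].

(** If all contributors to the new entry are known, distinctness of subset sums makes their set the
    only one that the algorithm can select. Otherwise the entry has a single contributor, which is
    new, and no known subset has its value. *)
Lemma sf_inv_step n lam (R : realType) (f : {perm 'I_n} -> R)
    (es1 es2 : seq (R * (tup n lam * tup n lam))) e st :
  (forall s, 0 <= f s) -> sums_distinct f ->
  pairwise (fun x y => x.1 <= y.1) (es1 ++ e :: es2) ->
  (forall x, x \in es1 ++ e :: es2 -> x.1 = fhat f x.2) ->
  (forall s, f s != 0 ->
     exists2 x, x \in es1 ++ e :: es2 & hits f x.2 = [set s]) ->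
  hits f e.2 != finset.set0 ->
  sf_inv f es1 st -> sf_inv f (rcons es1 e) (sf_step st e).
Proof.
move=> f0 fdist srt val wit ne0 [r [ur rP ->]].
have eval : e.1 = fhat f e.2 by apply: val; rewrite mem_cat mem_head orbT.
case: e srt val wit eval ne0 => q pos /= srt val wit qE ne0; rewrite qE.
have hitsN0 p s : s \in hits f p -> f s != 0 by rewrite inE => /andP[].
(* All masks with the right sum coincide, so the first one, which [sf_step] takes, is the set of
   contributors. *)
have maskE m : m \in masks (size (map f r)) ->
    \sum_(x <- mask m (map f r)) x == fhat f pos ->
    m = [seq s \in hits f pos | s <- r].
  rewrite mem_masks size_map => /eqP sm; rewrite sum_mask // fhatE => /eqP /fdist E.
  have {}E : [set s in mask m r] = hits f pos.
    apply: E => [s|]; last exact: hitsN0.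
    rewrite inE => /mem_mask; rewrite rP => /hasP[x _]; exact: hitsN0.
  apply: (@eq_from_nth _ false); first by rewrite size_map.
  rewrite sm => i ir; rewrite (nth_map 1%g) // -E inE in_mask //.
  by rewrite mem_nth // index_uniq.
have inrc s : (s \in hits f pos) || (s \in r) =
    has (fun x => s \in hits f x.2) (rcons es1 (fhat f pos, pos)).
  by rewrite has_rcons rP.
case: (boolP (hits f pos \subset r)) => [/fintype.subsetP sub|nsub].
  have : [seq s \in hits f pos | s <- r] \in [seq m <- masks (size (map f r)) |
        \sum_(x <- mask m (map f r)) x == fhat f pos].
    rewrite mem_filter mem_masks !size_map eqxx andbT sum_mask // fhatE.
    apply/eqP/eq_bigl => s; rewrite inE -filter_mask mem_filter.
    by apply/andb_idr => /sub.
  case Em : [seq _ <- _ | _] => [//|m ms] _.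
  have : m \in m :: ms by exact: mem_head.
  rewrite -Em mem_filter => /andP[mq mm].
  exists r; split=> //.
    move=> s; apply: etrans (inrc s); case: (boolP (_ \in hits _ _)) => // /sub.
    by move=> ->.
  congr pair; rewrite (maskE _ mm mq) zip_map -map_comp.
  apply: eq_map => s /=; apply/setP => p.
  transitivity ((if s \in hits f pos then p == pos else false) ||
                (p \in entry_set f es1 s)).
    by case: ifP => _; rewrite ?inE.
  rewrite [p \in entry_set _ _ _]inE [RHS]inE has_rcons /= (eq_sym pos).
  case: (p =P pos) => [->|_] /=; last by rewrite if_same.
  by case: (_ \in hits _ _) => /=; rewrite ?andbF ?andbT.
have [s0 s0h s0r] := fintype.subsetPn nsub.
(* A second contributor would make the entry larger than [f s0]. By sortedness the witness entry of
   [s0] would then have been read before, and [s0] would lie in [r]. *)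
have hE : hits f pos = [set s0].
  apply/eqP; apply: contraNT s0r => hn.
  have [[q1 p1] xin /= hx] := wit s0 (hitsN0 _ _ _ s0h).
  have q1E : q1 = f s0 by have /= -> := val _ xin; rewrite fhatE hx big_set1.
  have lt : q1 < fhat f pos.
    rewrite q1E fhatE (bigD1 s0) //= ltrDl lt_neqAle sumr_ge0 ?andbT //.
    rewrite eq_sym psumr_eq0 //; apply/allPn.
    have : hits f pos :\ s0 != finset.set0.
      by apply: contraNneq hn => h0; rewrite -(finset.setD1K s0h) h0 finset.setU0.
    case/set0Pn => s1; rewrite in_setD1 => /andP[s10 s1h].
    by exists s1; rewrite ?mem_index_enum // s1h s10 /=; exact: hitsN0 s1h.
  rewrite rP; apply/hasP; exists (q1, p1); last by rewrite /= hx set11.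
  move: srt; rewrite pairwise_cat /= => /and3P[_ _ /andP[/allP srt _]].
  move: xin; rewrite mem_cat inE => /or3P[//|/eqP[q1E' _]|/srt /=].
    by move: lt; rewrite q1E' qE ltxx.
  by rewrite qE leNgt lt.
(* A mask with this sum would, by distinctness, select [s0], which is not in [r]. *)
case Em : [seq _ <- _ | _] => [|m ms]; last first.
  have : m \in m :: ms by exact: mem_head.
  rewrite -Em mem_filter => /andP[mq mm].
  move: mq; rewrite sum_mask // fhatE => /eqP /fdist E.
  have {}E : [set s in mask m r] = hits f pos.
    apply: E => [s|]; last exact: hitsN0.
    rewrite inE => /mem_mask; rewrite rP => /hasP[x _]; exact: hitsN0.
  by move: s0h; rewrite -E inE => /mem_mask; rewrite (negPf s0r).
exists (rcons r s0); split.
- by rewrite rcons_uniq s0r.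
- by move=> s; apply: etrans (inrc s); rewrite hE mem_rcons !inE.
congr pair; first by rewrite map_rcons fhatE hE big_set1.
rewrite map_rcons; congr rcons.
  apply/eq_in_map => s sr; apply/setP => p.
  rewrite [LHS]inE [RHS]inE has_rcons /= andb_orl.
  case: (pos =P p) => [<-|//]; rewrite hE inE.
  by case: (s =P s0) sr s0r => // -> ->.
apply/setP => p; rewrite [LHS]inE [RHS]inE has_rcons /=.
rewrite andb_orl eq_sym; case: (pos =P p) => [<-|_] /=; first by rewrite s0h.
apply/esym/negbTE; apply: contra s0r => /andP[/hasP[x xe /eqP <-] s0x].
by rewrite rP; apply/hasP; exists x.
Qed.

(** The unread entries [es2] stay in the hypotheses because the order and the witnesses concern the
    whole list. *)
Lemma sf_foldl n lam (R : realType) (f : {perm 'I_n} -> R)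
    (es1 es2 : seq (R * (tup n lam * tup n lam))) :
  (forall s, 0 <= f s) -> sums_distinct f ->
  pairwise (fun x y => x.1 <= y.1) (es1 ++ es2) ->
  (forall x, x \in es1 ++ es2 -> x.1 = fhat f x.2) ->
  (forall x, x \in es1 ++ es2 -> hits f x.2 != finset.set0) ->
  (forall s, f s != 0 -> exists2 x, x \in es1 ++ es2 & hits f x.2 = [set s]) ->
  sf_inv f es1 (foldl (@sf_step _ _ _) ([::], [::]) es1).
Proof.
move=> f0 fdist; elim/last_ind: es1 es2 => [|es1 e IH] es2.
  by move=> *; exists [::].
rewrite cat_rcons foldl_rcons => srt val ne0 wit.
apply: (sf_inv_step (es2 := es2)) => //.
  by apply: ne0; rewrite mem_cat mem_head orbT.
exact: IH srt val ne0 wit.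
Qed.

Definition witnessed n lam (S : pred {perm 'I_n}) :=
  forall s, S s -> exists2 t : tup n lam, is_lpart t &
    forall s', S s' -> act s' t = act s t -> s' = s.

Lemma is_lpart_act n lam (s : {perm 'I_n}) (t : tup n lam) :
  is_lpart t -> is_lpart (act s t).
Proof.
case/and3P => /forallP ct /forallP dt /eqP Ut; apply/and3P; split.
- by apply/forallP => i; rewrite ffunE card_imset //; exact: perm_inj.
- apply/forallP => i; apply/forallP => j; apply/implyP => /(implyP (forallP (dt i) j)).
  by rewrite !ffunE imset_disjoint //; exact: perm_inj.
- apply/eqP/setP => x; rewrite inE; have : s^-1%g x \in \bigcup_i t i by rewrite Ut inE.
  case/bigcupP => i _ xi; apply/bigcupP; exists i => //.
  by rewrite ffunE -[x](permKV s) imset_f.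
Qed.

(** After the last entry, each [s] in the support of [f] is held with its value and its full matrix
    support. Injectivity of [suppM] then makes the lookup of [s] unambiguous. *)
Lemma recovers_of_witnessed n lam (R : realType) (f : {perm 'I_n} -> R) :
  (forall s, 0 <= f s) -> sums_distinct f ->
  @witnessed n lam (fun s => f s != 0) -> injective (@suppM n lam) ->
  recovers lam f.
Proof.
move=> f0 fdist wit injM; rewrite /recovers.
suff : exists2 r : seq {perm 'I_n}, forall s, (s \in r) = (f s != 0) &
    sparsest_fit lam f = [seq (f s, suppM lam s) | s <- r].
  case=> r rP ->; split=> [x /mapP[s _ ->]|s]; first by exists s.
  rewrite /recovered filter_map /=.
  rewrite (eq_filter (a2 := pred1 s)); last first.
    by move=> s' /=; exact: inj_eq.
  case: (boolP (s \in r)) => sr.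
    case E : (seq.filter _ _) => [|s' r'] /=.
      by move: sr; rewrite -has_pred1 has_filter E.
    have : s' \in s' :: r' by exact: mem_head.
    by rewrite -E mem_filter => /andP[/eqP ->].
  have /negbNE/eqP -> : ~~ (f s != 0) by rewrite -rP.
  case E : (seq.filter _ _) => [|s' r'] //=.
  by move: sr; rewrite -has_pred1 has_filter E.
rewrite /sparsest_fit; set ent := sort _ _.
have entP x : x \in ent = [&& is_lpart x.2.1, is_lpart x.2.2,
    x.1 == fhat f x.2 & fhat f x.2 != 0].
  rewrite /ent mem_sort; apply/mapP/and4P => [[p]|].
    rewrite mem_filter => /andP[pn0 /allpairsP[[s t] /= [sl tl pE]]] ->.
    by move: sl tl; rewrite !mem_enum pn0 pE /= => sl tl; split.
  case: x => q [s t] /= [? ? /eqP -> ?]; exists (s, t) => //.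
  rewrite mem_filter; apply/andP; split=> //; apply/allpairsP.
  by exists (s, t); split=> //=; rewrite mem_enum.
(* By nonnegativity nothing cancels, so an entry vanishes exactly when no permutation contributes to
   it. *)
have hits0 p : (hits f p != finset.set0) = (fhat f p != 0).
  rewrite fhatE psumr_eq0 //; apply/set0Pn/allPn => [[s sh]|[s _]].
    by exists s; [exact: mem_index_enum | rewrite sh /=; move: sh; rewrite inE => /andP[]].
  by rewrite negb_imply => /andP[]; exists s.
have := @sf_foldl n lam R f ent [::] f0 fdist; rewrite cats0 => /(_ _ _ _ _)[].
- rewrite -sorted_pairwise; first by apply: sort_sorted => x y; exact: le_total.
  by move=> y x z; exact: le_trans.
- by move=> x; rewrite entP => /and4P[_ _ /eqP].
- by move=> x; rewrite entP => /and4P[]; rewrite hits0.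
- move=> s fs; have [t tl tw] := wit s fs.
  have hE : hits f (act s t, t) = [set s].
    apply/setP => s'; rewrite !inE /=; apply/andP/eqP => [[fs' /eqP]|->//].
    exact: tw.
  exists (fhat f (act s t, t), (act s t, t)) => //.
  rewrite entP /= is_lpart_act // tl eqxx -hits0 hE /=.
  by apply/set0Pn; exists s; rewrite set11.
move=> r [ur rP ->]; exists r.
  move=> s; rewrite rP; apply/hasP/idP => [[x _]|fs].
    by rewrite inE => /andP[].
  have [t tl _] := wit s fs.
  have sh : s \in hits f (act s t, t) by rewrite inE fs /=.
  exists (fhat f (act s t, t), (act s t, t)) => //.
  by rewrite entP /= is_lpart_act // tl eqxx -hits0 /=; apply/set0Pn; exists s.
(* Each position in the matrix support of such an [s] carries a nonzero entry, so it has been read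
   and the entry set is complete. *)
rewrite zip_map; apply/eq_in_map => s; rewrite rP => /hasP[x _ sx].
congr pair; apply/setP => -[u t]; rewrite !inE /=.
have fs : f s != 0 by move: sx; rewrite inE => /andP[].
rewrite fs /=; apply/andP/and3P => [[/hasP[y]]|[ul tl /eqP Eu]].
  by rewrite entP => /and4P[ul tl _ _] /eqP yE; rewrite yE in ul tl.
split; last exact/eqP.
apply/hasP; exists (fhat f (u, t), (u, t)) => //.
by rewrite entP /= ul tl eqxx -hits0; apply/set0Pn; exists s; rewrite inE fs /= Eu.
Qed.

(** * Generic values *)

Fixpoint signed_sums (R : zmodType) (xs : seq R) : seq R :=
  if xs is x :: xs' then
    let S := signed_sums xs' in
    S ++ [seq x + y | y <- S] ++ [seq y - x | y <- S]
  else [:: 0].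

(** Each value is tested against those to its right, so genericity of values drawn in the order of
    [ps] reads [dissociated (rev ps)]. *)
Fixpoint dissociated (R : zmodType) (xs : seq R) : bool :=
  if xs is x :: xs' then (x \notin signed_sums xs') && dissociated xs' else true.

Lemma mem_signed_sums (R : pzRingType) (xs : seq R) (c : nat -> R) :
  (forall i, c i \in [:: 0; 1; -1]) ->
  \sum_(i < size xs) c i * xs`_i \in signed_sums xs.
Proof.
elim: xs c => [|x xs IH] c cP /=; first by rewrite big_ord0 inE.
rewrite big_ord_recl /= (eq_bigr (fun i : 'I_(size xs) => c i.+1 * xs`_i)) //.
set y := \sum_i _; have yS : y \in signed_sums xs.
  exact: IH (fun i => c i.+1) (fun i => cP i.+1).
rewrite !mem_cat.
have := cP 0%N; rewrite !inE => /or3P[] /eqP ->.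
- by rewrite mul0r add0r yS.
- by rewrite mul1r (map_f (fun z => x + z)) ?orbT.
- by rewrite mulN1r addrC (map_f (fun z => z - x)) ?orbT.
Qed.

(** A head coefficient 1 or -1 would express [x] as a signed sum of the tail; hence it is 0 and the
    relation passes to the tail. *)
Lemma dissociated_coef0 (R : pzRingType) (xs : seq R) (c : nat -> R) :
  dissociated xs -> (forall i, c i \in [:: 0; 1; -1]) ->
  \sum_(i < size xs) c i * xs`_i = 0 -> forall i, (i < size xs)%N -> c i = 0.
Proof.
elim: xs c => [//|x xs IH] c /= /andP[xN dxs] cP.
rewrite big_ord_recl /= (eq_bigr (fun i : 'I_(size xs) => c i.+1 * xs`_i)) //.
set y := \sum_i _; have yE : y = \sum_(i < size xs) c i.+1 * xs`_i by [].
have yS : y \in signed_sums xs.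
  by rewrite yE; apply: (@mem_signed_sums _ _ (fun i => c i.+1)).
have nyS : - y \in signed_sums xs.
  rewrite yE -sumrN; under eq_bigr do rewrite -mulNr.
  apply: (@mem_signed_sums _ _ (fun i => - c i.+1)) => i.
  by have := cP i.+1; rewrite !inE => /or3P[] /eqP ->; rewrite ?oppr0 ?opprK eqxx ?orbT.
have := cP 0%N; rewrite !inE => /or3P[] /eqP c0.
- rewrite c0 mul0r add0r => y0 [//|i] /= ix.
  by apply: (IH (fun i => c i.+1)) => //; rewrite -yE.
- by rewrite c0 mul1r => /eqP; rewrite addr_eq0 => /eqP xy; rewrite xy nyS in xN.
- rewrite c0 mulN1r => /eqP; rewrite addrC subr_eq0 => /eqP xy.
  by rewrite -xy yS in xN.
Qed.

(** * Integration away from finitely many values *)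

Import HBNNSimple.
Local Open Scope ereal_scope.

(* [h] need not be measurable: its integral is a supremum over the simple
   functions below it. *)
Lemma le_integral_itv_offseq (R : realType) (a b c : R) (h : R -> \bar R)
    (F : seq R) :
  (a <= b)%R -> (0 <= c)%R -> (forall x, 0 <= h x) ->
  (forall x, (a <= x <= b)%R -> x \notin F -> c%:E <= h x) ->
  (c * (b - a))%:E <= \int[@lebesgue_measure R]_(x in `[a, b]%classic) h x.
Proof.
move=> ab c0 h0 hF.
have mF : @measurable _ (measurableTypeR R) [set` F].
  exact/countable_measurable/finite_set_countable/finite_seq.
have mA : @measurable _ (measurableTypeR R)
    (`[a, b]%classic `\` [set` F])%classic by exact: measurableD.
(* The simple function is [c] times the indicator of the interval without [F]; removing the finite
   set [F] does not change the measure. *)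
have -> : (c * (b - a))%:E =
    sintegral (@lebesgue_measure R) (scale_nnsfun (indic_nnsfun R mA) c0).
  rewrite sintegralrM sintegral_indic // EFinM; congr (_ * _).
  have : lebesgue_measure (`[a, b]%classic : set R) = (b - a)%:E.
    rewrite lebesgue_measure_itv /= lte_fin; case: ltgtP ab => // <- _.
    by rewrite subrr.
  move=> <-; rewrite [LHS](@measureDI _ _ _ (@lebesgue_measure R) `[a, b]%classic [set` F]) //.
  rewrite [X in _ + X](_ : _ = 0) ?adde0 //.
  apply: countable_lebesgue_measure0; apply/finite_set_countable.
  by apply: (sub_finite_set (B := [set` F])); [exact: subIsetr | exact: finite_seq].
rewrite ge0_integralE; last by move=> *.
apply: ereal_sup_ubound => /=.
exists (scale_nnsfun (indic_nnsfun R mA) c0) => //= x.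
rewrite patchE mindicE; case: (boolP (x \in (_ `\` _)%classic)) => [|_].
  rewrite inE => -[/= xab /negP xF]; rewrite mulr1 ifT ?inE //.
  by apply: hF => //; move: xab; rewrite in_itv.
by rewrite mulr0; case: ifP.
Qed.

Lemma iterint_ge0 (R : realType) (a b : R) k (g : seq R -> \bar R) :
  (forall ps, 0 <= g ps) -> 0 <= iterint a b k g.
Proof.
elim: k g => [|k IH] g g0 /=; first exact: g0.
by apply: integral_ge0 => x _; exact: IH.
Qed.

(** [pre] holds the values already fixed, latest first. The next variable only has to avoid the
    finite list [signed_sums pre], which costs no measure. *)
Lemma iterint_ge_dissociated (R : realType) (a b : R) k (g : seq R -> \bar R)
    (pre : seq R) :
  (a <= b)%R -> (forall ps, 0 <= g ps) -> dissociated pre ->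
  (forall ps, size ps = k -> all (fun x => a <= x <= b)%R ps ->
     dissociated (rev ps ++ pre) -> 1 <= g ps) ->
  ((b - a) ^+ k)%:E <= iterint a b k g.
Proof.
move=> ab; elim: k g pre => [|k IH] g pre g0 dpre gP /=; first exact: gP.
rewrite exprSr; apply: (le_integral_itv_offseq (F := signed_sums pre)) => //.
- by rewrite exprn_ge0 ?subr_ge0.
- by move=> x; exact: iterint_ge0.
move=> x xab xN; apply: (IH _ (x :: pre)) => //=; first by rewrite xN.
move=> ps psk psab dps; apply: gP => /=; rewrite ?psk ?xab //.
by rewrite rev_cons cat_rcons.
Qed.

Local Close Scope ereal_scope.

(** * Distinct subset sums in the random model *)

Lemma sum_rev_coef (R : pzRingType) (ps : seq R) (c : nat -> R) :
  \sum_(i < size ps) c i * ps`_i =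
  \sum_(i < size (rev ps)) c (size ps - i.+1)%N * (rev ps)`_i.
Proof.
rewrite size_rev (reindex_inj rev_ord_inj) /=; apply: eq_bigr => i _.
by rewrite nth_rev.
Qed.

(** A permutation outside [ss] has index [size ss], where the default value 0 of [nth] is the right
    one. *)
Lemma model_f_nth n (R : realType) (ss : seq {perm 'I_n}) (ps : seq R) s :
  size ps = size ss -> model_f ss ps s = ps`_(index s ss).
Proof.
move=> sz; rewrite /model_f -/(index s ss); case: ifPn => //.
by rewrite -leqNgt => h; rewrite nth_default // sz.
Qed.

(** Equal sums over [A] and [B] give a relation among the values with coefficients in {-1, 0, 1},
    which must be trivial. *)
Lemma model_f_sums_distinct n (R : realType) (ss : seq {perm 'I_n})
    (ps : seq R) :
  size ps = size ss -> dissociated (rev ps) -> sums_distinct (model_f ss ps).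
Proof.
move=> sz dps A B A0 B0 eqAB.
have inss (C : {set {perm 'I_n}}) : (forall s, s \in C -> model_f ss ps s != 0) ->
    forall s, s \in C -> s \in ss.
  move=> C0 s /C0; rewrite -index_mem; apply: contraR.
  by rewrite -leqNgt model_f_nth // => h; rewrite nth_default // sz.
(* Only first occurrences count: a permutation drawn several times takes the value of its first
   draw. *)
pose u (C : {set {perm 'I_n}}) i : R :=
  ((nth 1%g ss i \in C) && (index (nth 1%g ss i) ss == i))%:R.
have sumE (C : {set {perm 'I_n}}) : (forall s, s \in C -> model_f ss ps s != 0) ->
    \sum_(s in C) model_f ss ps s = \sum_(i < size ps) u C i * ps`_i.
  (* The extra index [size ss] collects permutations outside [ss]; its class is empty because [C]
     lies in the support. *)
  move=> C0; rewrite (partition_big (fun s => inord (index s ss) : 'I_(size ss).+1) xpredT) //=.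
  rewrite sz big_ord_recr /= [X in _ + X]big1 ?addr0; last first.
    move=> s /andP[sC /eqP /(congr1 val)]; rewrite /= inordK ?ltnS ?index_size //.
    by move=> E; have := inss C C0 s sC; rewrite -index_mem E ltnn.
  apply: eq_bigr => i _; rewrite /u; case: (boolP (_ && _)) => [/andP[iC /eqP ii]|iN].
    rewrite mul1r (big_pred1 (nth 1%g ss i)) ?model_f_nth ?ii // => s /=.
    apply/andP/eqP => [[sC /eqP /(congr1 val)]|->].
      by rewrite /= inordK ?ltnS ?index_size // => <-; rewrite nth_index ?(inss C).
    by split=> //; rewrite -val_eqE /= inordK ?ltnS ?index_size // ii.
  rewrite mul0r big1 // => s /andP[sC /eqP /(congr1 val)].
  rewrite /= inordK ?ltnS ?index_size // => si; case/negP: iN.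
  by rewrite -si nth_index ?(inss C) // sC eqxx.
have c0 i : (i < size ps)%N -> u A i - u B i = 0.
  move=> ips; pose d j : R := u A (size ps - j.+1)%N - u B (size ps - j.+1)%N.
  have dP j : d j \in [:: 0; 1; -1].
    by rewrite /d /u !inE; do 2 case: (_ && _); rewrite ?subrr ?subr0 ?sub0r ?eqxx ?orbT.
  have d0 : \sum_(j < size (rev ps)) d j * (rev ps)`_j = 0.
    rewrite -(sum_rev_coef ps (fun i => u A i - u B i)).
    under eq_bigr do rewrite mulrBl.
    by rewrite sumrB -!sumE // eqAB subrr.
  have := dissociated_coef0 dps dP d0 (i := (size ps - i.+1)%N).
  rewrite size_rev /d (_ : size ps - (size ps - i.+1).+1 = i)%N; last by lia.
  by apply; rewrite ltn_subrL (leq_ltn_trans _ ips).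
have sub (C D : {set {perm 'I_n}}) : (forall s, s \in C -> model_f ss ps s != 0) ->
   (forall i, (i < size ps)%N -> u C i - u D i = 0) -> C \subset D.
  move=> C0 uCD; apply/fintype.subsetP => s sC; have sss := inss C C0 s sC.
  have := uCD (index s ss); rewrite sz index_mem => /(_ sss) /eqP.
  rewrite /u nth_index // sC eqxx /= subr_eq0 andbT.
  by case: (s \in D) => //; rewrite oner_eq0.
apply/eqP; rewrite finset.eqEsubset !sub // => i /c0 /eqP.
by rewrite subr_eq0 => /eqP ->; rewrite subrr.
Qed.

(** * Counting lambda-partitions and stabilizers *)

Lemma perm_onS (T : finType) (A B : {set T}) (s : {perm T}) :
  A \subset B -> perm_on A s -> perm_on B s.
Proof. by move=> AB As; apply: fintype.subset_trans As AB. Qed.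

Lemma imset_perm_eq (T : finType) (s : {perm T}) (A : {set T}) :
  (forall x, x \in A -> s x \in A) -> s @: A = A.
Proof.
move=> sA; apply/eqP; rewrite eqEcard card_imset ?leqnn ?andbT //; last exact: perm_inj.
by apply/fintype.subsetP => _ /imsetP[x xA ->]; exact: sA.
Qed.

(** Induction on the blocks: a permutation of [U] stabilizing [B i] is uniquely the product of one
    supported on [B i] and one supported on the rest of [U]. The last factorial counts the
    permutations of the uncovered points. *)
Lemma card_perm_on_stab (T : finType) (I : eqType) (B : I -> {set T})
    (r : seq I) (U : {set T}) :
  uniq r -> {in r, forall i, B i \subset U} ->
  {in r &, forall i j, i != j -> [disjoint B i & B j]} ->
  #|[set s : {perm T} | perm_on U s && all (fun i => s @: B i == B i) r]| =
  (\prod_(i <- r) (#|B i|)`! * (#|U| - \sum_(i <- r) #|B i|)`!)%N.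
Proof.
elim: r U => [|i r IH] U /=.
  move=> _ _ _; rewrite !big_nil subn0 mul1n -card_perm.
  by apply: eq_card => s; rewrite !inE andbT.
move=> /andP[ir ur] BU Bdis.
have BiU : B i \subset U by apply: BU; rewrite mem_head.
have disi j : j \in r -> [disjoint B i & B j].
  move=> jr; apply: Bdis; rewrite ?mem_head ?inE ?jr ?orbT //.
  by apply: contraNneq ir => ->.
have notin j x : j \in r -> x \in B j -> x \notin B i.
  by move=> jr xj; rewrite (disjointFl (disi j jr) xj).
rewrite !big_cons subnDA -mulnA -(cardsDS BiU) -IH //; first last.
- by move=> j k jr kr; apply: Bdis; rewrite inE ?jr ?kr orbT.
- move=> j jr; rewrite finset.subsetD BU ?inE ?jr ?orbT //=.
  by rewrite disjoint_sym disi.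
rewrite -card_perm -[X in (X * _)%N](cardsE (perm_on (B i))) -cardsX.
set H := [set s | _ && all _ r]; set G := [set s in perm_on (B i)].
pose f (pq : {perm T} * {perm T}) := (pq.1 * pq.2)%g.
have fB p q x : p \in G -> q \in H -> x \in B i -> (p * q)%g x = p x.
  rewrite !inE => pG /andP[qH _] xB; rewrite permM (out_perm qH) //.
  by rewrite !inE (perm_closed _ pG) xB.
have fN p q x : p \in G -> x \notin B i -> (p * q)%g x = q x.
  by rewrite !inE => pG xB; rewrite permM (out_perm pG).
rewrite -(card_in_imset (f := f) (D := finset.setX G H)); last first.
  move=> [p q] [p' q']; rewrite !finset.in_setX /= => /andP[pG qH] /andP[pG' qH'].
  rewrite /f /= => E; have pp : p = p'.
    apply/permP => x; case: (boolP (x \in B i)) => xB.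
      by rewrite -(fB p q) // E fB.
    by move: pG pG'; rewrite !inE => pG pG'; rewrite !(out_perm _ xB).
  by rewrite -pp in E *; rewrite (mulgI _ _ _ E).
apply: eq_card => s; apply/idP/imsetP.
  rewrite inE => /and3P[sU /eqP sBi /allP sB].
  have sN : s \in ('N(B i | 'P))%g.
    apply/astabsP => x; rewrite /= apermE -{1}sBi mem_imset //; exact: perm_inj.
  (* Surjectivity: [p] is [s] on [B i] and the identity elsewhere, so [p^-1 * s] fixes [B i]
     pointwise. *)
  pose p := restr_perm (B i) s.
  have pG : p \in G by rewrite inE; exact: restr_perm_on.
  have pN x : x \notin B i -> (p^-1)%g x = x.
    move=> xB; apply/eqP; rewrite -(inj_eq (@perm_inj _ p)) permKV.
    by rewrite (out_perm (restr_perm_on (B i) s) xB).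
  have pi x : x \in B i -> (p^-1 * s)%g x = x.
    move=> xB; rewrite permM -(restr_permE sN) -/p ?permKV //.
    by rewrite -(perm_closed _ (restr_perm_on (B i) s)) -/p permKV.
  exists (p, (p^-1 * s)%g); last by rewrite /f /= mulKVg.
  rewrite finset.in_setX pG inE /=; apply/andP; split.
    apply/fintype.subsetP => x; rewrite !inE; apply: contraR.
    rewrite negb_and negbK => /orP[xB|xU]; first by rewrite pi.
    rewrite permM pN ?(out_perm sU) //.
    by apply: contra xU; exact/fintype.subsetP.
  apply/allP => j jr; apply/eqP/imset_perm_eq => x xj.
  by rewrite permM pN ?(notin j) // -(eqP (sB j jr)) imset_f.
case=> -[p q]; rewrite finset.in_setX /f => /andP[/= pG qH] ->.
rewrite inE; have := pG; have := qH; rewrite !inE => /andP[qU /allP qB] pB.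
apply/and3P; split.
- apply: perm_onM; [apply: perm_onS pB => // | apply: perm_onS qU].
  exact: subsetDl.
- apply/eqP/imset_perm_eq => x xB.
  by rewrite fB // (perm_closed _ pB).
- apply/allP => j jr; apply/eqP/imset_perm_eq => x xj.
  by rewrite fN ?(notin j) // -(eqP (qB j jr)) imset_f.
Qed.

Lemma act_eqP n lam (s s' : {perm 'I_n}) (t t' : tup n lam) :
  reflect (forall i, s @: t i = s' @: t' i) (act s t == act s' t').
Proof.
apply: (iffP eqP) => [/ffunP E i|E]; first by have := E i; rewrite !ffunE.
by apply/ffunP => i; rewrite !ffunE.
Qed.

Lemma actM n lam (s s' : {perm 'I_n}) (t : tup n lam) :
  act (s * s')%g t = act s' (act s t).
Proof.
apply/ffunP => i; rewrite !ffunE -imset_comp.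
by apply: eq_imset => x; rewrite permM.
Qed.

Lemma act1 n lam (t : tup n lam) : act 1%g t = t.
Proof.
apply/ffunP => i; rewrite ffunE -[RHS]imset_id.
by apply: eq_imset => x; rewrite perm1.
Qed.

Lemma act_inj n lam (s : {perm 'I_n}) : injective (@Defs.act n lam s).
Proof.
by move=> t t' E; rewrite -[t]act1 -[t']act1 -(mulgV s) !actM E.
Qed.

(** The blocks exhaust the ground set, so the count of [card_perm_on_stab] has remaining factor 0! =
    1. *)
Lemma card_stab_lpart n lam (t : tup n lam) : is_lpart t ->
  #|[set s | act s t == t]| = (\prod_(x <- lam) x`!)%N.
Proof.
case/and3P => /forallP ct /forallP dt /eqP Ut.
have sub : {in enum 'I_(size lam), forall i, t i \subset [set: 'I_n]}.
  by move=> i _; rewrite finset.subsetT.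
have dis : {in enum 'I_(size lam) &, forall i j, i != j -> [disjoint t i & t j]}.
  by move=> i j _ _ ij; have /implyP := forallP (dt i) j; apply.
have := card_perm_on_stab (enum_uniq _) sub dis; rewrite !big_enum /= => E.
have -> : [set s | act s t == t] =
   [set s : {perm 'I_n} | perm_on [set: 'I_n] s &&
      all (fun i => s @: t i == t i) (enum 'I_(size lam))].
  apply/setP => s; have sT : perm_on [set: 'I_n] s.
    by apply/fintype.subsetP => x; rewrite inE.
  rewrite [LHS]inE [RHS]inE sT /= -{2}[t]act1.
  apply/act_eqP/allP => [h i _|h i].
    by rewrite h; apply/eqP; rewrite -[RHS]imset_id; apply: eq_imset => x; rewrite perm1.
  rewrite (eqP (h i _)) ?mem_enum // -[LHS]imset_id.
  by apply: eq_imset => x; rewrite perm1.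
have sz : (\sum_i #|t i| = n)%N.
  rewrite -[RHS]card_ord -cardsT -Ut; apply/esym.
  rewrite -[LHS]sum1_card partition_disjoint_bigcup //= => [|i j ij].
    by apply: eq_bigr => i _; rewrite sum1_card.
  by have /implyP := forallP (dt i) j; apply.
rewrite E cardsT card_ord sz subnn fact0 muln1 (big_nth 0%N) big_mkord.
by apply: eq_bigr => i _; rewrite (eqP (ct i)).
Qed.

(** A lambda-partition is a word giving each point the index of its block. Two such words have the
    same letter counts, so one is a rearrangement of the other. *)
Lemma lpart_trans n lam (t u : tup n lam) : is_lpart t -> is_lpart u ->
  exists s, act s t = u.
Proof.
have bE (v : tup n lam) x : is_lpart v ->
    exists2 i, [pick i | x \in v i] = Some i & x \in v i.
  case/and3P => _ _ /eqP Uv; case: pickP => [i xi|xN]; first by exists i.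
  by have : x \in \bigcup_i v i by [rewrite Uv inE]; case/bigcupP => i _; rewrite xN.
have bU (v : tup n lam) x i : is_lpart v ->
    ([pick i | x \in v i] == Some i) = (x \in v i).
  move=> vl; have [j -> xj] := bE v x vl; apply/eqP/idP => [[<-]//|xi].
  case/and3P: vl => _ /forallP/(_ i)/forallP/(_ j)/implyP dv _; congr Some.
  by apply/esym/eqP; apply: contraLR xj => /dv d; rewrite (disjointFr d xi).
move=> tl ul.
pose bt (v : tup n lam) := [tuple [pick i | x \in v i] | x < n].
have cnt (v : tup n lam) : is_lpart v -> forall o, count_mem o (bt v) =
    if o is Some i then nth 0%N lam i else 0%N.
  move=> vl o; rewrite /bt /= count_map -sum1_count big_enum_cond /= sum1dep_card.
  case: o => [i|].
    case/and3P: (vl) => /forallP/(_ i)/eqP <- _ _.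
    by apply: eq_card => x; rewrite inE bU.
  by apply: eq_card0 => x; rewrite inE; have [j ->] := bE v x vl.
have /tuple_permP[p pE] : perm_eq (bt t) (bt u).
  by apply/allP => o _; rewrite /= !cnt.
exists p; apply/ffunP => i; rewrite ffunE; apply/eqP.
case/and3P: (tl) => /forallP/(_ i)/eqP ct _ _.
case/and3P: (ul) => /forallP/(_ i)/eqP cu _ _.
rewrite eqEcard card_imset ?ct ?cu ?leqnn ?andbT; last exact: perm_inj.
apply/fintype.subsetP => _ /imsetP[x xt ->]; rewrite -bU //.
have : tnth (bt t) x = tnth (bt u) (p x).
  rewrite [LHS](tnth_nth None) pE -(tnth_nth None [tuple tnth (bt u) (p i) | i < n]).
  by rewrite tnth_mktuple.
by rewrite !tnth_mktuple => <-; rewrite bU.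
Qed.

(** Orbit-stabilizer: the action is transitive, and the permutations sending [t] to a given [u] form
    a translate of the stabilizer of [t]. *)
Lemma Dlam_fact n lam (t : tup n lam) : is_lpart t ->
  (Dlam n lam * \prod_(x <- lam) x`! = n`!)%N.
Proof.
move=> tl; rewrite -(card_stab_lpart tl) /Dlam -sum_nat_const.
have -> : n`! = (\sum_(s : {perm 'I_n}) 1)%N by rewrite sum1_card card_Sn.
rewrite [RHS](partition_big (fun s => act s t) (@is_lpart n lam)) /=; last first.
  by move=> s _; exact: is_lpart_act.
apply: eq_bigr => u ul; have [s0 s0E] := lpart_trans tl ul.
rewrite sum1dep_card -[LHS](card_imset _ (mulIg s0)).
apply: eq_card => s; apply/imsetP/idP => [[s' + ->]|].
  by rewrite !inE actM => /eqP -> /=; rewrite s0E.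
rewrite !inE => /eqP su; exists (s * s0^-1)%g; last by rewrite mulgKV.
by rewrite inE actM su -s0E -actM mulgV act1.
Qed.

(** * Lambda-partitions with disjoint tails *)

Lemma card_ord_itv n u v : (v <= n)%N ->
  #|[set x : 'I_n | (u <= x < v)%N]| = (v - u)%N.
Proof.
move=> vn; rewrite -sum1dep_card -(big_mkord (fun i => u <= i < v)%N (fun=> 1%N)).
case: (leqP v u) => [vu|uv].
  rewrite big_pred0 ?(eqP vu) // => i; apply/negbTE/negP => /andP[ui iv].
  by move: (leq_trans iv (leq_trans vu ui)); rewrite ltnn.
rewrite (big_cat_nat (n := u)) //= ?(leq_trans (ltnW uv) vn) //.
rewrite (big_cat_nat (m := u) (n := v)) //= ?(ltnW uv) //.
rewrite [X in (X + _)%N]big_nat_cond big_pred0; last by move=> i; lia.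
rewrite [X in (_ + (_ + X))%N]big_nat_cond.
rewrite [X in (_ + (_ + X))%N]big_pred0; last by move=> i; lia.
rewrite add0n addn0.
rewrite big_nat_cond (eq_bigl (fun i => (u <= i < v)%N && true)) => [|i].
  by rewrite -big_nat_cond sum_nat_const_nat muln1.
by rewrite andbT andbb.
Qed.

Lemma sumn_takeS s i : (i < size s)%N ->
  sumn (take i.+1 s) = (sumn (take i s) + nth 0 s i)%N.
Proof. by move=> si; rewrite (take_nth 0%N) // sumn_rcons. Qed.

Lemma sumn_take_mono s i j : (i <= j)%N -> (sumn (take i s) <= sumn (take j s))%N.
Proof.
by move=> ij; rewrite -(subnKC ij) takeD sumn_cat leq_addr.
Qed.

Lemma sumn_take_le s i : (sumn (take i s) <= sumn s)%N.
Proof. by rewrite -[X in (_ <= sumn X)%N](cat_take_drop i) sumn_cat leq_addr. Qed.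

Definition tail_block n (tl : seq nat) (m i : nat) : {set 'I_n} :=
  [set x : 'I_n | (m * sumn tl + sumn (take i tl) <= x
                   < m * sumn tl + sumn (take i.+1 tl))%N].

Lemma card_tail_block n tl m i : (m.+1 * sumn tl <= n)%N -> (i < size tl)%N ->
  #|tail_block n tl m i| = nth 0%N tl i.
Proof.
move=> mn itl; have := sumn_take_le tl i.+1; have := sumn_takeS itl => E le.
by rewrite card_ord_itv; [rewrite E; lia | nia].
Qed.

Lemma tail_block_inj n tl m i m' i' (x : 'I_n) :
  x \in tail_block n tl m i -> x \in tail_block n tl m' i' -> m = m' /\ i = i'.
Proof.
(* The lexicographic order of the index pairs is the order of the intervals from left to right. *)
wlog: m i m' i' / ((m < m') || ((m == m') && (i <= i')))%N.
  move=> H x1 x2; case: (ltngtP m m') => mm.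
  - by apply: H => //; rewrite mm.
  - by have [|-> ->] := H m' i' m i _ x2 x1; first by rewrite mm.
  subst m'; case: (leqP i i') => ii; first by apply: H; rewrite ?eqxx ?ii ?orbT.
  by have [|_ ->] := H m i' m i _ x2 x1; first by rewrite eqxx (ltnW ii) orbT.
rewrite !inE => H /andP[a1 a2] /andP[b1 b2].
case/orP: H => [mm|/andP[/eqP E ii]].
  by have := sumn_take_le tl i.+1; nia.
subst m'; case: ltngtP ii => // ii _.
by have := sumn_take_mono tl ii; lia.
Qed.

Definition shifted_lpart n l0 tl m : tup n (l0 :: tl) :=
  [ffun i : 'I_(size tl).+1 =>
     if unlift ord0 i is Some j then tail_block n tl m j
     else ~: \bigcup_(j < size tl) tail_block n tl m j].

Lemma shifted_lpart_lift n l0 tl m (j : 'I_(size tl)) :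
  shifted_lpart n l0 tl m (lift ord0 j) = tail_block n tl m j.
Proof. by rewrite ffunE liftK. Qed.

Lemma shifted_lpartP n l0 tl m :
  n = (l0 + sumn tl)%N -> (m.+1 * sumn tl <= n)%N ->
  is_lpart (shifted_lpart n l0 tl m).
Proof.
move=> nE mn; apply/and3P; split.
- apply/forallP => i; rewrite ffunE; case: unliftP => [j ->|->] /=.
    by rewrite card_tail_block.
  rewrite cardsCs finset.setCK card_ord.
  have -> : #|\bigcup_(j < size tl) tail_block n tl m j| = sumn tl.
    rewrite -sum1_card partition_disjoint_bigcup /=; last first.
      move=> j k jk; apply/pred0P => x /=; apply/negbTE/negP => /andP[xj xk].
      by have [_ /val_inj E] := tail_block_inj xj xk; rewrite E eqxx in jk.
    rewrite sumnE (big_nth 0%N) big_mkord; apply: eq_bigr => j _.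
    by rewrite sum1_card card_tail_block.
  by rewrite nE addnK.
- apply/forallP => i; apply/forallP => j; apply/implyP.
  rewrite !ffunE; case: unliftP => [i' ->|->]; case: unliftP => [j' ->|->] // ij.
  + apply/pred0P => x /=; apply/negbTE/negP => /andP[xj xk].
    by have [_ /val_inj E] := tail_block_inj xj xk; rewrite E eqxx in ij.
  + rewrite -finset.subsets_disjoint; exact: (finset.bigcup_sup i').
  + rewrite disjoint_sym -finset.subsets_disjoint; exact: (finset.bigcup_sup j').
- apply/eqP/setP => x; rewrite inE; apply/bigcupP.
  case: (boolP (x \in \bigcup_(j < size tl) tail_block n tl m j)) => xU.
    case/bigcupP: xU => j _ xj; exists (lift ord0 j) => //.
    by rewrite shifted_lpart_lift.
  by exists ord0 => //; rewrite ffunE unlift_none inE.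
Qed.

(** The tail blocks for all [m] in [J] form one pairwise disjoint family, so a single stabilizer
    count treats them together. Keeping only the tail conditions gives an upper bound. *)
Lemma card_stab_shifted n l0 tl M (J : {set 'I_M}) :
  n = (l0 + sumn tl)%N -> (M * sumn tl <= n)%N ->
  (#|[set s | [forall m in J, act s (shifted_lpart n l0 tl m) ==
                 shifted_lpart n l0 tl m]]| <=
   (\prod_(x <- tl) x`!) ^ #|J| * (n - #|J| * sumn tl)`!)%N.
Proof.
move=> nE Mn.
pose r := enum [set x : 'I_M * 'I_(size tl) | x.1 \in J].
pose B (x : 'I_M * 'I_(size tl)) := tail_block n tl x.1 x.2.
have cB x : #|B x| = nth 0%N tl x.2.
  by rewrite card_tail_block //; have := ltn_ord x.1; nia.
have sub : {in r, forall i, B i \subset [set: 'I_n]}.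
  by move=> i _; apply/fintype.subsetP => x; rewrite inE.
have dis : {in r &, forall i j, i != j -> [disjoint B i & B j]}.
  move=> i j _ _ ij; apply/pred0P => x /=; apply/negbTE/negP => /andP[xi xj].
  have [/val_inj E1 /val_inj E2] := tail_block_inj xi xj.
  by case/eqP: ij; case: i j E1 E2 {xi xj} => ? ? [? ?] /= -> ->.
have := card_perm_on_stab (enum_uniq _) sub dis; rewrite -/r.
rewrite !big_enum /= cardsT card_ord => E.
apply: leq_trans (_ : _ <= #|[set s : {perm 'I_n} |
    perm_on [set: 'I_n] s && all (fun i => s @: B i == B i) r]|)%N _.
  apply/subset_leq_card/fintype.subsetP => s; rewrite !inE => /forall_inP h.
  apply/andP; split; first by apply/fintype.subsetP => x; rewrite inE.
  apply/allP => -[m i]; rewrite mem_enum inE /= => mJ.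
  have /eqP/ffunP/(_ (lift ord0 i)) := h m mJ.
  by rewrite !ffunE liftK => ->.
rewrite {}E; apply: eq_leq; congr muln.
  rewrite (eq_bigl (fun x : 'I_M * 'I_(size tl) => (x.1 \in J) && true)); last first.
    by move=> x; rewrite inE andbT.
  rewrite (eq_bigr (fun x : 'I_M * 'I_(size tl) => (nth 0%N tl x.2)`!)); last first.
    by move=> x _; rewrite cB.
  rewrite -(pair_big_dep (mem J) (fun _ _ => true)
    (fun _ i => (nth 0%N tl (i : 'I_(size tl)))`!)) /=.
  rewrite prod_nat_const; congr expn.
  by rewrite (big_nth 0%N) big_mkord.
congr ((_ - _)`!).
rewrite (eq_bigl (fun x : 'I_M * 'I_(size tl) => (x.1 \in J) && true)); last first.
  by move=> x; rewrite inE andbT.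
rewrite (eq_bigr (fun x : 'I_M * 'I_(size tl) => nth 0%N tl x.2)); last first.
  by move=> x _; rewrite cB.
rewrite -(pair_big_dep (mem J) (fun _ _ => true)
  (fun _ i => nth 0%N tl (i : 'I_(size tl)))) /=.
rewrite sum_nat_const; congr muln.
by rewrite sumnE (big_nth 0%N) big_mkord.
Qed.

(** * Factorial inequalities *)

Lemma leq_ffact m n j : (m <= n)%N -> (m ^_ j <= n ^_ j)%N.
Proof.
elim: j m n => [//|j IH] m n mn; rewrite !ffactnS leq_mul ?IH //.
by rewrite -!subn1 leq_sub2r.
Qed.

(** After cancelling (n-j)! and (n-i-j)!, this compares the falling factorials of length [j] from
    n-i and from n. *)
Lemma leq_fact_mul n i j : (i + j <= n)%N ->
  ((n - i)`! * (n - j)`! <= n`! * (n - (i + j))`!)%N.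
Proof.
move=> ijn; have jn : (j <= n)%N by lia. have jni : (j <= n - i)%N by lia.
rewrite -(ffact_fact jni) -(ffact_fact jn) -subnDA mulnAC leq_mul //.
by rewrite leq_mul // leq_ffact // leq_subr.
Qed.

(** Divided by powers of n!, it bounds the product of the ratios (n - j_k)! / n! by the single ratio
    for the sum of the j_k: spreading the constraints over several permutations never makes them
    likelier. *)
Lemma leq_fact_prod (I : Type) (r : seq I) (j : I -> nat) n :
  (\sum_(k <- r) j k <= n)%N ->
  (n`! * \prod_(k <- r) (n - j k)`! <=
   n`! ^ size r * (n - \sum_(k <- r) j k)`!)%N.
Proof.
elim: r => [|k r IH]; first by rewrite !big_nil subn0 muln1 mul1n.
rewrite !big_cons /= expnS => le.
have {}IH := IH (leq_trans (leq_addl _ _) le).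
rewrite mulnCA (leq_trans (leq_mul (leqnn _) IH)) // mulnCA -mulnA [X in (_ <= X)%N]mulnCA.
by rewrite leq_mul // leq_fact_mul.
Qed.

Lemma card_family_prod (aT : finType) (rT : finType) (F : aT -> {set rT}) :
  #|[set g : {ffun aT -> rT} | [forall x, g x \in F x]]| = (\prod_x #|F x|)%N.
Proof.
have := card_family (fun x => mem (F x)).
rewrite foldrE big_map enumT => <-.
apply: eq_card => g; rewrite inE; apply/forallP/familyP => h x; exact: h.
Qed.

(** * Colliding tuples of permutations *)

Section Collisions.

Variables (n l0 : nat) (tl : seq nat) (M K : nat).
Hypothesis nE : n = (l0 + sumn tl)%N.
Hypothesis Mn : (M * sumn tl <= n)%N.

Local Notation t m := (shifted_lpart n l0 tl m).

Definition collisions (i : 'I_K) (phi : {ffun 'I_M -> 'I_K}) :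
    {set {ffun 'I_K -> {perm 'I_n}}} :=
  [set g : {ffun 'I_K -> {perm 'I_n}} |
     [forall m : 'I_M, act (g (phi m)) (t m) == act (g i) (t m)]].

(** Once [g i] is fixed, the other coordinates are independent, and [g k] lies in a translate of the
    joint stabilizer of the [t m] with [phi m = k]. The product of these sizes is largest when [phi]
    is constant, by [leq_fact_prod]. *)
Lemma card_collisions i (phi : {ffun 'I_M -> 'I_K}) :
  (forall m, phi m != i) ->
  (#|collisions i phi| * n`! <=
   (\prod_(x <- tl) x`!) ^ M * (n - M * sumn tl)`! * n`! ^ K)%N.
Proof.
move=> phiN; pose J k := [set m | phi m == k].
have sumJ : (\sum_k #|J k| = M)%N.
  rewrite -[RHS]card_ord -sum1_card (partition_big phi xpredT) //=.
  by apply: eq_bigr => k _; rewrite sum1dep_card.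
pose Fix k := [set s | [forall m in J k, act s (t m) == t m]].
pose F s k := if k == i then [set s] else [set (u * s)%g | u in Fix k].
have le1 : (#|collisions i phi| <= \sum_(s : {perm 'I_n}) \prod_k #|F s k|)%N.
  rewrite -sum1_card (partition_big (fun g : {ffun 'I_K -> {perm 'I_n}} => g i) xpredT) //=.
  apply: leq_sum => s _; rewrite -card_family_prod sum1dep_card.
  apply/subset_leq_card/fintype.subsetP => g; rewrite !inE => /andP[/forallP h /eqP gi].
  apply/forallP => k; rewrite /F; case: eqP => [->|_]; first by rewrite gi set11.
  apply/imsetP; exists (g k * s^-1)%g; last by rewrite mulgKV.
  rewrite inE; apply/forall_inP => m; rewrite inE => /eqP mk.
  by rewrite actM -mk (eqP (h m)) gi -actM mulgV act1.
pose P := (\prod_(x <- tl) x`!)%N.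
(* Since [phi] avoids [i], the set [J i] is empty and its factor on the right is n!, which absorbs
   the n! on the left. *)
have le2 s : (n`! * \prod_k #|F s k| <=
    \prod_k (P ^ #|J k| * (n - #|J k| * sumn tl)`!))%N.
  rewrite (bigD1 i) //= [X in (_ <= X)%N](bigD1 i) //=.
  have -> : #|J i| = 0%N.
    by apply: eq_card0 => m; rewrite inE (negPf (phiN m)).
  rewrite /F eqxx cards1 mul1n expn0 mul0n subn0 mul1n leq_mul //.
  apply: leq_prod => k ki; rewrite (negPf ki) card_imset; last exact: mulIg.
  exact: card_stab_shifted.
apply: leq_trans (_ : _ <= n`! * \prod_k (P ^ #|J k| * (n - #|J k| * sumn tl)`!))%N _.
  rewrite mulnC (leq_trans (leq_mul (leqnn _) le1)) // big_distrr /=.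
  rewrite -[X in (_ <= X * _)%N](card_Sn n) -sum_nat_const.
  by apply: leq_sum => s _; exact: le2.
rewrite big_split /= mulnCA -expn_sum sumJ -mulnA leq_mul //.
have := @leq_fact_prod _ (index_enum 'I_K) (fun k => #|J k| * sumn tl)%N n.
rewrite -big_distrl /= sumJ => /(_ Mn).
have -> : size (index_enum 'I_K) = K.
  by rewrite -[RHS]card_ord cardT /index_enum; unlock; rewrite enumT.
by rewrite (mulnC (_ ^ K)%N).
Qed.

(** Permutations are compared rather than indices, since draws with replacement may repeat. *)
Definition separated (ss : K.-tuple {perm 'I_n}) : bool :=
  [forall i, exists m : 'I_M, forall k,
     (act (tnth ss k) (t m) == act (tnth ss i) (t m)) ==>
     (tnth ss k == tnth ss i)].

(** Union bound over at most K^(M+1) pairs of an index [i] and a map [phi] choosing, for each [m], a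
    draw that collides with draw [i] on [t m]. *)
Lemma card_unseparated :
  (#|[set ss | ~~ separated ss]| * n`! <=
   K ^ M.+1 * (\prod_(x <- tl) x`!) ^ M * (n - M * sumn tl)`! * n`! ^ K)%N.
Proof.
pose fn (ss : K.-tuple {perm 'I_n}) := [ffun k => tnth ss k].
have fn_inj : injective fn.
  move=> ss ss' /ffunP E; apply: eq_from_tnth => k.
  by have := E k; rewrite !ffunE.
rewrite -(card_imset _ fn_inj).
pose bad (ip : 'I_K * {ffun 'I_M -> 'I_K}) := [forall m, ip.2 m != ip.1].
have sub : fn @: [set ss | ~~ separated ss] \subset
    \bigcup_(ip | bad ip) collisions ip.1 ip.2.
  apply/fintype.subsetP => _ /imsetP[ss + ->]; rewrite inE.
  case/forallPn => i /existsPn h.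
  have {}h (m : 'I_M) : exists k,
      (act (tnth ss k) (t m) == act (tnth ss i) (t m)) && (tnth ss k != tnth ss i).
    by have /forallPn[k] := h m; rewrite negb_imply; exists k.
  apply/bigcupP; exists (i, [ffun m => xchoose (h m)]).
    apply/forallP => m; rewrite /= ffunE.
    by have /andP[_] := xchooseP (h m); apply: contraNneq => {1}->.
  rewrite inE; apply/forallP => m; rewrite /= !ffunE.
  by have /andP[] := xchooseP (h m).
apply: leq_trans (leq_mul (subset_leq_card sub) (leqnn _)) _.
apply: leq_trans (leq_mul (_ : _ <= \sum_(ip | bad ip) #|collisions ip.1 ip.2|)%N (leqnn _)) _.
  elim/big_rec2: _ => [|ip A u _ le]; first by rewrite cards0.
  by rewrite cardsU (leq_trans (leq_subr _ _)) // leq_add2l.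
rewrite big_distrl /=.
apply: leq_trans (_ : _ <= \sum_(ip | bad ip)
    (\prod_(x <- tl) x`!) ^ M * (n - M * sumn tl)`! * n`! ^ K)%N _.
  by apply: leq_sum => ip /forallP h; exact: card_collisions.
rewrite sum_nat_const -!mulnA leq_mul //.
by rewrite (leq_trans (max_card _)) // card_prod card_ffun !card_ord expnS.
Qed.

End Collisions.

(** * Entropy estimates *)

(** Factor by factor, (k-i)/k <= (s-i)/s. *)
Lemma leq_expn_ffact s k j : (k <= s)%N -> (s ^ j * k ^_ j <= s ^_ j * k ^ j)%N.
Proof.
move=> ks; elim: j => [//|j IH]; rewrite !ffactnSr !expnSr.
rewrite mulnACA [X in (_ <= X)%N]mulnACA leq_mul // mulnBr mulnBl mulnC.
by rewrite leq_sub2l // mulnC leq_mul.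
Qed.

Lemma leq_expn_bin s k : (k <= s)%N -> (s ^ k <= 'C(s, k) * k ^ k)%N.
Proof.
move=> ks; rewrite -(leq_pmul2r (fact_gt0 k)) mulnAC bin_ffact -ffactnn.
exact: leq_expn_ffact.
Qed.

Lemma ln_ge_1Binv (R : realType) (x : R) : 0 < x -> 1 - x^-1 <= ln x.
Proof.
move=> x0; have := @le_ln1Dx R (x^-1 - 1).
rewrite addrCA subrr addr0 lnV ?posrE // => h.
have : - ln x <= x^-1 - 1 by apply: h; rewrite ltrBrDl subrr invr_gt0.
lra.
Qed.

Definition xlnx (R : realType) (k : nat) : R := k%:R * ln k%:R.

(** Let k <= m and s = k + m. The left side is k ln(s/k) + m ln(s/m), and the right side is 3 ln
    C(s,k). The first term is at most ln C(s,k) because (s/k)^k <= C(s,k). The second is at most k,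
    hence at most 2k ln(s/k), because s >= 2k gives ln(s/k) >= 1/2. *)
Lemma xlnx_superadd (R : realType) (k m : nat) :
  xlnx R (k + m) - xlnx R k - xlnx R m <=
  3 * (ln ((k + m)`!)%:R - ln (k`!)%:R - ln (m`!)%:R).
Proof.
wlog km : k m / (k <= m)%N.
  move=> H; case: (leqP k m) => [/H //|/ltnW /H].
  by rewrite addnC; lra.
case: (posnP k) => [->|k0].
  by rewrite /xlnx add0n fact0 ln1 mul0r !subr0 !subrr mulr0.
have m0 : (0 < m)%N by exact: leq_trans k0 km.
have lnf : ln ((k + m)`!)%:R - ln (k`!)%:R - ln (m`!)%:R =
    ln ('C(k + m, k))%:R :> R.
  have /(congr1 (fun j => j%:R : R)) := bin_fact (leq_addr m k).
  rewrite addKn !natrM => <-.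
  rewrite !lnM ?posrE ?mulr_gt0 ?ltr0n ?fact_gt0 ?bin_gt0 ?leq_addr //.
  by move: (ln _) (ln _) (ln _); clear; move=> x y z; lra.
rewrite lnf; set s := (k + m)%N.
have k0R : 0 < k%:R :> R by rewrite ltr0n.
have m0R : 0 < m%:R :> R by rewrite ltr0n.
have sE : s%:R = k%:R + m%:R :> R by rewrite natrD.
have s0R : 0 < s%:R :> R by rewrite sE addr_gt0.
have kmR : k%:R <= m%:R :> R by rewrite ler_nat.
have s0 : (0 < s)%N by rewrite addn_gt0 k0.
have bin0 : (0 < 'C(s, k))%N by rewrite bin_gt0 leq_addr.
have H1 : k%:R * (ln s%:R - ln k%:R) <= ln ('C(s, k))%:R :> R.
  have : (s ^ k)%:R <= ('C(s, k) * k ^ k)%:R :> R.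
    by rewrite ler_nat leq_expn_bin // leq_addr.
  rewrite natrM !natrX -ler_ln ?posrE ?mulr_gt0 ?exprn_gt0 ?ltr0n //.
  rewrite lnM ?posrE ?exprn_gt0 ?ltr0n // !lnXn //.
  by rewrite -[_ *+ k]mulr_natl -[X in _ + X]mulr_natl mulrBr lerBlDr.
have H2 : 1 / 2 <= ln s%:R - ln k%:R :> R.
  rewrite -ln_div ?posrE //; apply: le_trans (ln_ge_1Binv _); last exact: divr_gt0.
  rewrite invf_div; have : k%:R / s%:R <= 1 / 2 :> R.
    by rewrite ler_pdivrMr // sE; move: kmR; clear; lra.
  by clear; lra.
have H3 : m%:R * (ln s%:R - ln m%:R) <= k%:R :> R.
  rewrite -ln_div ?posrE // sE mulrDl divff ?gt_eqF // addrC.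
  have : ln (1 + k%:R / m%:R) <= k%:R / m%:R :> R.
    by apply: le_ln1Dx; apply: lt_le_trans (divr_ge0 (ltW k0R) (ltW m0R)); rewrite ltrN10.
  by rewrite -(ler_pM2l m0R) mulrCA divff ?gt_eqF // mulr1.
have H4 : k%:R * (1 / 2) <= k%:R * (ln s%:R - ln k%:R) :> R by rewrite ler_pM2l.
rewrite /xlnx; move: H1 H2 H3 H4; rewrite {}sE.
move: (k%:R) (m%:R) (ln ('C(s, k))%:R) (ln (k%:R + m%:R)) (ln k%:R) (ln m%:R).
clear; move=> x y c ls lk lm; lra.
Qed.

Lemma xlnx_sumn (R : realType) (lam : seq nat) :
  xlnx R (sumn lam) - \sum_(x <- lam) xlnx R x <=
  3 * (ln ((sumn lam)`!)%:R - \sum_(x <- lam) ln (x`!)%:R).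
Proof.
elim: lam => [|x lam IH] /=.
  by rewrite !big_nil /xlnx mul0r fact0 ln1 !subr0 mulr0.
rewrite !big_cons; have := xlnx_superadd R x (sumn lam); lra.
Qed.

(** The exponential series of e^n dominates its term n^n / n!. *)
Lemma expr_le_expR_fact (R : realType) n : n%:R ^+ n <= expR n%:R * (n`!)%:R :> R.
Proof.
case: n => [|n]; first by rewrite expr0 fact0 expR0 mulr1.
have := @expR_ge1Dxn R n.+1%:R n (ler0n _ _).
have f0 : 0 < (n.+1`!)%:R :> R by rewrite ltr0n fact_gt0.
rewrite -(ler_pM2r f0) mulrDl mul1r -mulrA mulVf ?gt_eqF // mulr1.
by apply: le_trans; rewrite lerDr ltW.
Qed.

Lemma leq_fact_expn n m : (m <= n)%N -> (m`! <= n ^ m)%N.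
Proof.
by elim: m => [//|m IH] mn; rewrite factS expnS leq_mul // IH // ltnW.
Qed.

Lemma leq_expn_mul_fact n k : (k <= n)%N -> (n ^ k * (n - k)`! <= n ^ n)%N.
Proof.
move=> kn; rewrite -[X in (_ <= _ ^ X)%N](subnKC kn) expnD leq_mul //.
exact/leq_fact_expn/leq_subr.
Qed.

Lemma leq_fact_addn l0 L : ((l0 + L)`! <= (l0 + L) ^ L * l0`!)%N.
Proof.
have := ffact_fact (leq_addl l0 L); rewrite addnK => <-; rewrite leq_mul //.
elim: L (l0 + L)%N => [//|L IH] m; rewrite ffactnSr expnSr leq_mul //.
exact: leq_subr.
Qed.

(** Since 1 - l0/n = L/n for n = l0 + L, the floor is that of n/L, an integer quotient. *)
Lemma floor_inv_1Bratio (R : realType) l0 L : (0 < L)%N ->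
  (Num.floor (1 / (1 - l0%:R / (l0 + L)%:R) : R))%:~R = ((l0 + L) %/ L)%:R :> R.
Proof.
move=> L0; have L0R : 0 < L%:R :> R by rewrite ltr0n.
have n0R : 0 < (l0 + L)%:R :> R by rewrite ltr0n addn_gt0 L0 orbT.
have -> : 1 / (1 - l0%:R / (l0 + L)%:R) = (l0 + L)%:R / L%:R :> R.
  rewrite -[1 - _](_ : L%:R / (l0 + L)%:R = _) ?div1r ?invf_div //.
  rewrite -[X in _ = X - _](divff (lt0r_neq0 n0R)) -mulrBl natrD.
  by rewrite addrAC subrr add0r.
have -> : Num.floor ((l0 + L)%:R / L%:R : R) = Posz ((l0 + L) %/ L)%N.
  apply/eqP; rewrite Num.Theory.floor_eq -[(_ + 1)%R]PoszD -!pmulrn.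
  rewrite ler_pdivlMr // ltr_pdivrMr // -!natrM ler_nat ltr_nat leq_divM /=.
  by rewrite addn1 ltn_ceil.
by rewrite -pmulrn.
Qed.

(** * From the entropy condition on K to the failure bound *)

Section RateBound.

Variables (R : realType) (l0 : nat) (tl : seq nat).
Hypothesis l0_gt0 : (0 < l0)%N.
Hypothesis tl_gt0 : all (fun x => 0 < x)%N tl.
Hypothesis L_gt0 : (0 < sumn tl)%N.

Let n := (l0 + sumn tl)%N.
Let lam := l0 :: tl.
Let M := (n %/ sumn tl)%N.
Let h1 : R := Hent n lam R - Hent' n lam R.

Let n_gt0 : (0 < n)%N. Proof. by rewrite addn_gt0 l0_gt0. Qed.
Let nR : 0 < n%:R :> R. Proof. by rewrite ltr0n. Qed.
Let l0R : 0 < l0%:R :> R. Proof. by rewrite ltr0n. Qed.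

Lemma entropy_head : n%:R * h1 = l0%:R * (ln n%:R - ln l0%:R).
Proof.
rewrite /h1 /Hent /Hent' -(big_mkord xpredT (fun i => alpha n lam R i * ln (alpha n lam R i))).
rewrite big_ltn // /alpha /= opprD addrK ln_div ?posrE //.
have := nR; move: n%:R l0%:R => x y x0; field.
by rewrite gt_eqF.
Qed.

Lemma entropy_total : n%:R * Hent n lam R =
  xlnx R n - \sum_(x <- lam) xlnx R x.
Proof.
have lam_gt0 : all (fun x => 0 < x)%N lam by rewrite /= l0_gt0.
rewrite /Hent -(big_mkord xpredT (fun i => alpha n lam R i * ln (alpha n lam R i))).
have -> : \sum_(0 <= i < size lam) alpha n lam R i * ln (alpha n lam R i) =
    \sum_(x <- lam) (x%:R / n%:R * ln (x%:R / n%:R)).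
  by rewrite [RHS](big_nth 0%N).
have -> : xlnx R n = \sum_(x <- lam) x%:R * ln n%:R.
  by rewrite -mulr_suml -natr_sum /xlnx -sumnE.
rewrite -sumrB mulrN mulr_sumr -sumrN; apply: eq_big_seq => x xlam.
have x0 : 0 < x%:R :> R by rewrite ltr0n (allP lam_gt0).
rewrite ln_div ?posrE // /xlnx; have := nR; move: n%:R x%:R => u v u0; field.
by rewrite gt_eqF.
Qed.

(** [D] is the multinomial coefficient, so its logarithm is the difference of log-factorials in
    [xlnx_sumn]. *)
Lemma ln_Dlam_ge (D : nat) : (D * \prod_(x <- lam) x`! = n`!)%N ->
  n%:R * Hent n lam R <= 3 * ln D%:R.
Proof.
move=> DE; rewrite entropy_total; apply: le_trans (xlnx_sumn R lam) _.
have D0 : (0 < D)%N by have := fact_gt0 n; rewrite -DE muln_gt0 => /andP[].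
have -> : sumn lam = n by [].
rewrite ler_pM2l // -DE natrM lnM ?posrE ?ltr0n //; last first.
  by rewrite prodn_gt0 // => i; exact: fact_gt0.
rewrite natr_prod (_ : ln (\prod_(x <- lam) _) = \sum_(x <- lam) ln (x`!)%:R) ?addrK //.
elim: lam => [|x s IH]; first by rewrite !big_nil ln1.
rewrite !big_cons lnM ?IH ?posrE ?ltr0n ?fact_gt0 //.
by apply: prodr_gt0 => i _; rewrite ltr0n fact_gt0.
Qed.

Let X : R := M%:R * (n%:R * h1).

Let M_gt0 : (0 < M)%N. Proof. by rewrite divn_gt0 // leq_addl. Qed.
Let ML : (M * sumn tl <= n)%N. Proof. exact: leq_divM. Qed.

Let lnr_ge : (sumn tl)%:R / n%:R <= ln n%:R - ln l0%:R :> R.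
Proof.
rewrite -ln_div ?posrE //; apply: le_trans (ln_ge_1Binv _); last exact: divr_gt0.
rewrite invf_div lerBrDr -mulrDl -natrD addnC divff //.
by rewrite gt_eqF.
Qed.

(** X = M l0 ln(n/l0) >= l0 (M L / n), and n < (M+1) L <= 2 M L. *)
Lemma exponent_ge_half : l0%:R / 2 <= X.
Proof.
rewrite /X entropy_head mulrCA ler_pM2l //.
apply: le_trans (_ : M%:R * ((sumn tl)%:R / n%:R) <= _); last by rewrite ler_pM2l ?ltr0n.
rewrite mulrA ler_pdivlMr // -natrM mulrC -[2^-1]div1r mulrA mulr1 ler_pdivrMr //.
rewrite -natrM ler_nat; have := ltn_ceil n L_gt0; rewrite -/M mulSn => h.
have := leq_mul M_gt0 (leqnn (sumn tl)); lia.
Qed.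

(** Split ln n = ln(n/l0) + ln l0: the first term is at most X because M l0 >= 1, and the second is
    at most l0 <= 2X. *)
Lemma exponent_ge_ln : ln n%:R <= 3 * X.
Proof.
have h : ln n%:R - ln l0%:R <= X.
  rewrite /X entropy_head mulrA ler_peMl //.
    by apply: le_trans lnr_ge; rewrite divr_ge0.
  by rewrite -natrM ler1n muln_gt0 M_gt0.
have := ln_sublinear l0R; have := exponent_ge_half; move: h.
move: l0%:R X (ln _) (ln _); move=> a b x y; lra.
Qed.

(** Take logarithms and multiply by M+1, which cancels the denominator in [gamma]. The loss is 24 M
    (h1/H) ln D, and n H <= 3 ln D makes it at least 8 M n h1 = 8X; this is where 24 = 3 * 8 comes
    from. *)
Lemma powR_gamma_le (D K : nat) : (D * \prod_(x <- lam) x`! = n`!)%N ->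
  K%:R <= D%:R `^ gamma n lam (24 : R) ->
  K%:R ^+ M.+1 <= D%:R ^+ M * expR (- 8 * X).
Proof.
move=> DE KD; have D0 : (0 < D)%N by have := fact_gt0 n; rewrite -DE muln_gt0 => /andP[].
have D0R : 0 < D%:R :> R by rewrite ltr0n.
have -> : D%:R ^+ M = expR (M%:R * ln D%:R) :> R by rewrite expRM_natl lnK ?posrE.
rewrite -expRD; case: (posnP K) => [->|K0]; first by rewrite expr0n expR_ge0.
have K0R : 0 < K%:R :> R by rewrite ltr0n.
have -> : K%:R ^+ M.+1 = expR (M.+1%:R * ln K%:R) :> R by rewrite expRM_natl lnK ?posrE.
rewrite ler_expR.
have {}KD : ln K%:R <= gamma n lam (24 : R) * ln D%:R.
  by rewrite -ln_powR ler_ln ?posrE ?powR_gt0.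
have M1 : 0 < M%:R + 1 :> R by rewrite ltr_wpDl.
have h1_ge0 : 0 <= n%:R * h1.
  rewrite entropy_head mulr_ge0 //; apply: le_trans lnr_ge.
  by rewrite divr_ge0.
have h1_gt0 : 0 < h1.
  rewrite -(pmulr_rgt0 _ nR) entropy_head mulr_gt0 //; apply: lt_le_trans lnr_ge.
  by rewrite divr_gt0 // ltr0n.
have H0 : 0 < Hent n lam R.
  apply: lt_le_trans h1_gt0 _; rewrite /h1 gerBl /Hent' oppr_ge0.
  rewrite big_nat_cond sumr_le0 // => i /andP[/andP[i0 isz] _].
  rewrite /alpha mulr_ge0_le0 ?divr_ge0 // ln_le0 // ler_pdivrMr // mul1r ler_nat.
  have : nth 0%N lam i \in lam by exact: mem_nth.
  rewrite -[n]/(sumn lam) => /perm_to_rem/perm_sumn -> /=; exact: leq_addr.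
have Mfl : Mfl n lam R = M%:R.
  by rewrite /Mfl /alpha /= floor_inv_1Bratio.
rewrite /gamma Mfl -/h1 in KD.
have lnD := ln_Dlam_ge DE.
have key : 8 * (n%:R * h1) <= 24 * (h1 / Hent n lam R) * ln D%:R.
  have -> : 24 * (h1 / Hent n lam R) * ln D%:R = 24 * h1 * ln D%:R / Hent n lam R.
    by rewrite mulrA mulrAC.
  rewrite ler_pdivlMr //; move: lnD; rewrite -(ler_pM2l h1_gt0).
  move: h1 n%:R (Hent n lam R) (ln D%:R); move=> a b c d; lra.
have : (M%:R + 1) * ln K%:R <= M%:R * (1 - 24 * (h1 / Hent n lam R)) * ln D%:R.
  apply: le_trans (_ : (M%:R + 1) * (M%:R / (M%:R + 1) *
      (1 - 24 * (h1 / Hent n lam R)) * ln D%:R) <= _); first by rewrite ler_pM2l.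
  by rewrite !mulrA [(_ + 1) * M%:R]mulrC mulfK // gt_eqF.
rewrite -[M.+1%:R]natr1 => /le_trans; apply.
rewrite /X; have M0 : 0 <= M%:R :> R by [].
have := ler_wpM2l M0 key; move: (h1 / _) (n%:R * h1) => y x.
move: M%:R (ln D%:R) => m d; lra.
Qed.

Lemma rate_bound (D K : nat) : (D * \prod_(x <- lam) x`! = n`!)%N ->
  K%:R <= D%:R `^ gamma n lam (24 : R) ->
  (K ^ M.+1 * (\prod_(x <- tl) x`!) ^ M * (n - M * sumn tl)`! * n)%:R <=
    (n`!)%:R :> R.
Proof.
move=> DE KD; have KDX := powR_gamma_le DE KD.
set P := (\prod_(x <- tl) x`!)%N; rewrite big_cons -/P in DE.
have X3 := exponent_ge_ln; have n0 := n_gt0.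
have nexp : n%:R = expR (ln n%:R) :> R by rewrite lnK ?posrE.
have lnn0 : 0 <= ln n%:R :> R by rewrite ln_ge0 // ler1n.
set Q := (P ^ M * (n - M * sumn tl)`!)%N.
have -> : (K ^ M.+1 * P ^ M * (n - M * sumn tl)`! * n)%N = (K ^ M.+1 * (Q * n))%N.
  by rewrite /Q !mulnA.
have KX : (K ^ M.+1 * (Q * n))%:R <= (D ^ M * Q)%:R * expR (- 8 * X + ln n%:R) :> R.
  rewrite expRD -nexp [X in X <= _]natrM [(D ^ M * Q)%:R]natrM !natrX mulrACA -natrM.
  by apply: ler_wpM2r.
apply: le_trans KX _.
(* For M = 1 the product D P l0! is exactly n!, so ln n <= 3X suffices. *)
case: (leqP M 1) => [M1|M2].
  have {}M1 : M = 1%N by apply/eqP; rewrite eqn_leq M1 M_gt0.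
  have -> : (D ^ M * Q = n`!)%N.
    by rewrite /Q M1 !expn1 mul1n addnK -DE [(P * _)%N]mulnC.
  rewrite ler_piMr // -[X in _ <= X]expR0 ler_expR; move: lnn0 X3.
  by move: X (ln _) => x y; lra.
(* Here D P = n!/l0! <= n^L, so D^M Q <= n^(M L) (n - M L)! <= n^n. *)
have DQ : (D ^ M * Q)%:R <= expR n%:R * (n`!)%:R :> R.
  apply: le_trans (expr_le_expR_fact R n); rewrite -natrX ler_nat.
  apply: leq_trans (leq_expn_mul_fact ML).
  rewrite /Q mulnA -expnMn leq_mul // [(M * _)%N]mulnC expnM leq_exp2r //.
  rewrite -(leq_pmul2r (fact_gt0 l0)) -mulnA [(P * _)%N]mulnC DE.
  exact: leq_fact_addn.
apply: le_trans (ler_wpM2r (expR_ge0 _) DQ) _.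
rewrite mulrAC -expRD ler_piMl // -[X in _ <= X]expR0 ler_expR.
(* M >= 2 forces L <= n/2, hence l0 >= n/2 and X >= n/4. Then 8X >= 2n >= n + ln n absorbs both e^n
   and the factor n; this fixes the constant 8. *)
have l0n : n%:R <= 2 * l0%:R :> R.
  rewrite -natrM ler_nat; have := leq_mul M2 (leqnn (sumn tl)); move: ML.
  rewrite /n; lia.
have := exponent_ge_half; have := ln_sublinear nR; move: l0n.
by move: n%:R l0%:R X (ln _) => x y z t; lra.
Qed.

End RateBound.

(** * The success probability *)

(** If [s] and [s'] differ at [z], move [t] by [u] so that block [i] contains [z] but not w =
    s'^-1(s z). Then [s z] lies in block [i] of the image under [s] but not under [s']. *)
Lemma suppM_inj n lam (t : tup n lam) i x y :
  is_lpart t -> x \in t i -> y \notin t i -> injective (@suppM n lam).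
Proof.
move=> tl xt yt s s' E; apply/permP => z; apply/eqP/negPn/negP => neq.
pose w := (s'^-1 (s z))%g.
have zw : z != w by apply: contraNneq neq => zw; rewrite [X in _ == s' X]zw /w permKV.
pose u := (tperm x z * tperm (tperm x z y) w)%g.
have xy : x != y by apply: contraNneq yt => <-.
have ux : u x = z.
  rewrite permM tpermL tpermD //; last by rewrite eq_sym.
  by apply: contraNneq xy => E'; rewrite -(inj_eq (@perm_inj _ (tperm x z))) tpermL E'.
have uy : u y = w by rewrite permM tpermL.
have ul := is_lpart_act u tl.
have aE : act s' (act u t) = act s (act u t).
  have : (act s (act u t), act u t) \in suppM lam s by rewrite inE /= is_lpart_act //= ul eqxx.
  by rewrite E inE /= => /and3P[_ _ /eqP].
have : s z \in act s (act u t) i by rewrite !ffunE -ux !imset_f.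
rewrite -aE !ffunE => /imsetP[v vt sv].
have vw : v = w by rewrite /w sv permK.
case/imsetP: vt => y' y't vy; case/negP: yt.
by rewrite -(perm_inj (etrans uy (etrans (esym vw) vy))) in y't.
Qed.

Lemma success_of_separated n l0 tl M K (R : realType) (a b : R)
    (ss : K.-tuple {perm 'I_n}) (ps : seq R) :
  n = (l0 + sumn tl)%N -> (0 < sumn tl)%N -> (0 < l0)%N ->
  (M * sumn tl <= n)%N -> 0 < a ->
  size ps = K -> all (fun x => a <= x <= b) ps -> dissociated (rev ps) ->
  separated l0 tl M ss -> success (l0 :: tl) ss ps.
Proof.
move=> nE L0 l00 Mn a0 psK psab dps /forallP sep; apply/asboolP.
have szE : size ps = size ss by rewrite size_tuple.
have fin s : model_f ss ps s != 0 -> s \in ss.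
  rewrite -index_mem; apply: contraR.
  by rewrite -leqNgt model_f_nth // => h; rewrite nth_default // szE.
have t0l : is_lpart (shifted_lpart n l0 tl 0).
  by apply: shifted_lpartP => //; rewrite mul1n nE leq_addl.
apply: recovers_of_witnessed.
- move=> s; rewrite model_f_nth //; case: (ltnP (index s ss) (size ps)) => h.
    have /andP[ax _] := allP psab _ (mem_nth 0 h).
    exact: le_trans (ltW a0) ax.
  by rewrite nth_default.
- exact: model_f_sums_distinct.
- move=> s /fin/tnthP[i ->]; have /existsP[m /forallP h] := sep i.
  exists (shifted_lpart n l0 tl m).
    apply: shifted_lpartP => //; apply: leq_trans Mn; rewrite leq_mul //; exact: ltn_ord.
  move=> s' /fin/tnthP[k ->] /eqP E.
  by apply/eqP; exact: (implyP (h k)).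
(* The head block has [l0 > 0] points and misses [sumn tl > 0] points, so it can serve as the block
   in [suppM_inj]. *)
- have /and3P[/forallP/(_ ord0)/eqP c0 _ _] := t0l.
  have : (0 < #|shifted_lpart n l0 tl 0 ord0|)%N by rewrite c0.
  case/card_gt0P => x x0.
  have : (0 < #|~: shifted_lpart n l0 tl 0 ord0|)%N.
    by rewrite cardsCs finset.setCK card_ord c0 /= nE addKn.
  case/card_gt0P => y; rewrite inE => y0.
  exact: suppM_inj t0l x0 y0.
Qed.

(** A separated tuple succeeds for almost all values, so its iterated integral is at least the full
    volume (b-a)^K; the other tuples contribute nonnegatively. *)
Lemma success_prob_ge n l0 tl M K (R : realType) (a b : R) :
  n = (l0 + sumn tl)%N -> (0 < sumn tl)%N -> (0 < l0)%N ->
  (M * sumn tl <= n)%N -> 0 < a -> a < b ->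
  ((#|[set ss : K.-tuple {perm 'I_n} | separated l0 tl M ss]|%:R /
      (n`! ^ K)%:R)%:E <= success_prob n (l0 :: tl) a b K)%E.
Proof.
move=> nE L0 l00 Mn a0 ab; rewrite /success_prob.
have ba : 0 < (b - a) ^+ K by rewrite exprn_gt0 // subr_gt0.
have f0 : 0 < (n`! ^ K)%:R :> R by rewrite ltr0n expn_gt0 fact_gt0.
have -> : #|[set ss : K.-tuple {perm 'I_n} | separated l0 tl M ss]|%:R /
    (n`! ^ K)%:R = (b - a) ^- K / (n`! ^ K)%:R *
    \sum_(ss : K.-tuple {perm 'I_n}) (if separated l0 tl M ss then (b - a) ^+ K else 0).
  rewrite -big_mkcond /=.
  rewrite (eq_bigl [in [set ss : K.-tuple {perm 'I_n} | separated l0 tl M ss]]) => [|ss].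
    by rewrite sumr_const -[_ *+ #|_|]mulr_natl [RHS]mulrC -mulrA mulVKf ?gt_eqF.
  by rewrite !inE.
rewrite EFinM lee_pmul2l //; last by rewrite lte_fin divr_gt0 // invr_gt0.
rewrite -sumEFin; apply: lee_sum => ss _; case: ifPn => [sep|_].
  apply: (iterint_ge_dissociated (pre := [::])) => //; first exact: ltW.
  move=> ps psK psab; rewrite cats0 => dps.
  by rewrite (success_of_separated nE L0 l00 Mn a0 psK psab dps sep).
by apply: iterint_ge0 => ps; rewrite lee_fin.
Qed.

Unset Implicit Arguments.

(** The threshold [N] precedes [lam] and [K], so the convergence is uniform in both. The condition
    on [size lam] excludes the one-part partition, where 1 - alpha_1 = 0. *)
Theorem theorem6 (R : realType) :
  exists C C' : R, 0 < C /\ 0 < C' /\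
  forall a b : R, 0 < a -> a < b ->
  forall eps : R, 0 < eps ->
  exists N : nat, forall (n : nat) (lam : seq nat) (K : nat),
    (N <= n)%N -> is_partition n lam -> (1 < size lam)%N ->
    K%:R <= C * (Dlam n lam)%:R `^ gamma n lam C' ->
    ((1 - eps)%:E <= success_prob n lam a b K)%E.
Proof.
exists 1, 24; do 2 split=> //.
move=> a b a0 ab eps eps0.
(* The failure probability will be at most 1/n, so n >= 1/eps suffices. *)
exists (Num.bound eps^-1) => n lam K Nn /and3P[_ pos /eqP nE] sz; rewrite mul1r => KD.
case: lam pos nE sz KD => [//|l0 tl] /= /andP[l00 tl0] /esym nE sz KD.
have L0 : (0 < sumn tl)%N.
  by case: tl tl0 sz {nE KD} => //= x tl /andP[x0 _] _; rewrite addn_gt0 x0.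
pose M := (n %/ sumn tl)%N.
have Mn : (M * sumn tl <= n)%N by exact: leq_divM.
apply: le_trans (success_prob_ge (M := M) K nE L0 l00 Mn a0 ab).
have tl1 : is_lpart (shifted_lpart n l0 tl 0).
  by apply: shifted_lpartP => //; rewrite mul1n nE leq_addl.
have DE := Dlam_fact tl1.
have rate := @rate_bound R l0 tl l00 tl0 L0 (Dlam n (l0 :: tl)) K.
rewrite -nE -/M in rate; have {}rate := rate DE KD.
have unsep := @card_unseparated n l0 tl M K nE Mn.
have n0 : (0 < n)%N by rewrite nE addn_gt0 l00.
have f0 : (0 < n`! ^ K)%N by rewrite expn_gt0 fact_gt0.
(* Multiplying the union bound by n and inserting the rate bound leaves a common factor n!, which
   cancels. *)
have few : (#|[set ss : K.-tuple {perm 'I_n} | ~~ separated l0 tl M ss]| * n <= n`! ^ K)%N.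
  rewrite -(leq_pmul2r (fact_gt0 n)) mulnAC; apply: leq_trans (leq_mul unsep (leqnn n)) _.
  by rewrite mulnAC [X in (_ <= X)%N]mulnC leq_mul // -(ler_nat R).
have tot : (#|[set ss : K.-tuple {perm 'I_n} | separated l0 tl M ss]| +
    #|[set ss : K.-tuple {perm 'I_n} | ~~ separated l0 tl M ss]| = n`! ^ K)%N.
  rewrite -[RHS](_ : #|{: K.-tuple {perm 'I_n}}| = _)%N; last by rewrite card_tuple card_Sn.
  rewrite -(cardsC [set ss : K.-tuple {perm 'I_n} | separated l0 tl M ss]); congr addn.
  by apply: eq_card => ss; rewrite !inE.
rewrite lee_fin ler_pdivlMr ?ltr0n // mulrBl mul1r -{1}tot natrD lerBlDr lerD2l.
have epsn : eps^-1 <= n%:R.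
  apply: le_trans (ltW (archi_boundP _)) _; first by rewrite invr_ge0 ltW.
  by rewrite ler_nat.
rewrite -(ler_pM2r (_ : 0 < n%:R)) ?ltr0n // -natrM.
apply: le_trans (_ : (n`! ^ K)%:R <= _); first by rewrite ler_nat.
rewrite mulrAC ler_peMl //.
by rewrite mulrC -ler_pdivrMr // div1r.
Qed.
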